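(* For every integer $d\geq 3$ there exists a set $\mathcal{X}\subset\mathbb{R}^d$ of unit vectors spanning $|\mathcal{X}|=2(d-1)(d-2)$ biangular lines with $A(\mathcal{X})\subseteq\{\pm 1/5,\pm 3/5\}$.
   Context: For a finite set $\mathcal{X}\subset\mathbb{R}^d$ of unit vectors put $A(\mathcal{X}):=\{\langle x,x'\rangle\colon x\neq x';\ x,x'\in\mathcal{X}\}$, with the standard inner product. The set $\mathcal{X}$ spans a system of biangular lines (the lines through the origin in the directions $x\in\mathcal{X}$) if $-1\notin A(\mathcal{X})$ and $|\{\gamma^2\colon\gamma\in A(\mathcal{X})\}|\leq 2$. Since $-1\notin A(\mathcal{X})$, distinct vectors span distinct lines, so the number of lines is $|\mathcal{X}|$. *)

(* Defs.v *)
From mathcomp Require Import all_boot all_order all_algebra finmap.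
From mathcomp Require Import reals.

Set Implicit Arguments.
Unset Strict Implicit.
Unset Printing Implicit Defensive.

Import Order.TTheory GRing.Theory Num.Theory.

Local Open Scope fset_scope.
Local Open Scope ring_scope.

Definition inner (R : realType) (d : nat) (x y : 'rV[R]_d) : R :=
  \sum_(i < d) x 0 i * y 0 i.

(* The norm that MathComp-Analysis puts on 'rV[R]_d is the sup norm, so the
   Euclidean norm is introduced separately. *)
Definition enorm (R : realType) (d : nat) (x : 'rV[R]_d) : R :=
  Num.sqrt (inner x x).

Definition unit_vectors (R : realType) (d : nat) (X : {fset 'rV[R]_d}) : Prop :=
  forall x, x \in X -> enorm x = 1.

Definition angle_set (R : realType) (d : nat) (X : {fset 'rV[R]_d}) : {fset R} :=
  [fset inner x y | x in X, y in X & x != y].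

(* As -1 is excluded from the angle set, distinct unit vectors of X span
   distinct lines, so the number of lines is #|` X|. *)
Definition spans_biangular_lines (R : realType) (d : nat)
    (X : {fset 'rV[R]_d}) : Prop :=
  [/\ unit_vectors X,
      -1 \notin angle_set X
    & (#|` [fset g ^+ 2 | g in angle_set X] | <= 2)%N].

(* Main.v *)
Require Import Defs.
From mathcomp Require Import all_boot all_order all_algebra finmap.
From mathcomp Require Import reals.
From mathcomp Require Import zify ring lra.

Set Implicit Arguments.
Unset Strict Implicit.
Unset Printing Implicit Defensive.

Import Order.TTheory GRing.Theory Num.Theory.

Local Open Scope fset_scope.
Local Open Scope ring_scope.

(** The root system D_(d-1) consists of 2(d-1)(d-2) integer vectors of squared
    length 2.  Scale its roots by sqrt(2/5) and lift them to the common height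
    sqrt(1/5) in one extra dimension.  By Cauchy-Schwarz two distinct roots
    have an inner product k in {-2, -1, 0, 1}, so the lifted unit vectors have
    inner product (2k + 1)/5, which lies in {-3/5, -1/5, 1/5, 3/5}. *)

Definition dot (n : nat) (u v : 'I_n -> int) : int := \sum_i u i * v i.

(** The squared norm of [u + v] is nonnegative and that of [u - v] is positive, which bounds the
    integer [dot u v] below by -2 and strictly above by 2. *)
Lemma dot_norm2_range (n : nat) (u v : 'I_n -> int) :
  dot u u = 2 -> dot v v = 2 -> ~ u =1 v ->
  [\/ dot u v = -2, dot u v = -1, dot u v = 0 | dot u v = 1].
Proof.
move=> uu vv neq_uv.
have sqrD (s : int) : s * s = 1 ->
    \sum_i (u i + s * v i) ^+ 2 = 4 + 2 * s * dot u v.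
  move=> ss; have -> : 4 + 2 * s * dot u v
      = dot u u + 2 * s * dot u v + s * s * dot v v by rewrite uu vv ss; ring.
  rewrite /dot !mulr_sumr -!big_split; apply: eq_bigr => i _ /=; ring.
have ge_m2 : 0 <= 4 + 2 * 1 * dot u v.
  by rewrite -sqrD // sumr_ge0 // => i _; rewrite sqr_ge0.
have lt_2 : 0 < 4 + 2 * -1 * dot u v.
  rewrite -sqrD // lt_def sumr_ge0 ?andbT; last by move=> i _; rewrite sqr_ge0.
  apply/negP; rewrite psumr_eq0 => [/allP eq_uv|i _]; last by rewrite sqr_ge0.
  apply: neq_uv => i; have := eq_uv i (mem_index_enum i).
  by rewrite /= sqrf_eq0 mulN1r subr_eq0 => /eqP.
have: -2 <= dot u v < 2 by lia.
move: (dot u v) => k hk.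
have : [|| k == -2, k == -1, k == 0 | k == 1] by lia.
by case/or4P => /eqP; [apply: Or41|apply: Or42|apply: Or43|apply: Or44].
Qed.

(* A root is encoded by its support p.1 and the set p.2 of its negative entries. *)
Definition root_vec (n : nat) (p : {set 'I_n} * {set 'I_n}) (i : 'I_n) : int :=
  if i \in p.1 then (-1) ^+ (i \in p.2) else 0.

(** Keeping the sign set inside the support makes the encoding unique: signs off the support would
    not change the vector. *)
Definition root_index (n : nat) : {set {set 'I_n} * {set 'I_n}} :=
  [set p : {set _} * {set _} | (#|p.1| == 2)%N & p.2 \subset p.1].

Lemma dot_root_vec (n : nat) p : p \in root_index n ->
  dot (root_vec p) (root_vec p) = 2.
Proof.
rewrite inE => /andP[/eqP cardD _].
transitivity (#|p.1|%:R : int); last by rewrite cardD.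
rewrite /dot -sumr_const [RHS]big_mkcond.
apply: eq_bigr => i _; rewrite /root_vec.
by case: (i \in p.1); rewrite ?mul0r // -expr2 sqrr_sign.
Qed.

Lemma root_vec_inj (n : nat) p q : p \in root_index n -> q \in root_index n ->
  root_vec p =1 root_vec q -> p = q.
Proof.
case: p q => [D E] [D' E']; rewrite !inE /= => /andP[_ /subsetP sED].
move=> /andP[_ /subsetP sED'] eq_pq; congr pair; apply/setP => i;
  move: (eq_pq i) (sED i) (sED' i); rewrite /root_vec /=;
  case: (i \in D); case: (i \in D') => //; case: (i \in E); case: (i \in E') => //.
(* What remains is an index outside both supports but in exactly one sign set, against the
   inclusions. *)
- by move=> _ /(_ isT).
- by move=> _ _ /(_ isT).
Qed.

(** Each of the ['C(n, 2)] supports carries four sign sets. *)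
Lemma card_root_index (n : nat) : #|root_index n| = (2 * n * n.-1)%N.
Proof.
rewrite -sum1_card (eq_bigl (fun p : {set 'I_n} * {set 'I_n} =>
  (#|p.1| == 2)%N && (p.2 \subset p.1))); last by move=> p; rewrite inE.
rewrite -(pair_big_dep (fun D : {set 'I_n} => #|D| == 2)%N
  (fun D E : {set 'I_n} => E \subset D)
  (fun _ _ => 1%N)) /=.
under eq_bigr => D /eqP cD.
  have -> : (\sum_(E : {set 'I_n} | E \subset D) 1 = 4)%N.
    have <- : #|powerset D| = 4%N by rewrite card_powerset cD.
    by rewrite -sum1_card; apply: eq_bigl => E; rewrite powersetE.
  over.
rewrite sum_nat_const -cardsE card_draws card_ord.
by have := mul_bin_left n 1; rewrite bin1 subn1; lia.
Qed.

Section Lifting.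
Variables (R : realType) (n : nat).

(** Inner products become a + bk with k the integer one. Unit length (k = 2) forces a + 2b = 1, and
    b = 2a makes the values at k and -1 - k opposite; hence a = 1/5 and b = 2/5. *)
Definition lift_root (v : 'I_n -> int) : 'rV[R]_n.+1 :=
  row_mx (Num.sqrt (1 / 5))%:M (\row_i (Num.sqrt (2 / 5) * (v i)%:~R))
    : 'rV_(1 + n).

Lemma inner_lift_root (u v : 'I_n -> int) :
  inner (lift_root u) (lift_root v) = 1 / 5 + 2 / 5 * (dot u v)%:~R.
Proof.
rewrite /inner /lift_root (@big_split_ord _ _ _ 1 n) big_ord1 /= !(@row_mxEl _ 1 1 n) !mxE eqxx.
rewrite -expr2 sqr_sqrtr; last by lra.
congr (_ + _); rewrite /dot rmorph_sum mulr_sumr; apply: eq_bigr => i _.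
rewrite !(@row_mxEr _ 1 1 n) !mxE mulrACA -expr2 sqr_sqrtr ?rmorphM //; lra.
Qed.

Lemma lift_root_inj (u v : 'I_n -> int) : lift_root u = lift_root v -> u =1 v.
Proof.
move=> /(@eq_row_mx _ 1 1 n)[_ /rowP eq_uv] i; have := eq_uv i; rewrite !mxE.
have s_neq0 : Num.sqrt (2 / 5 : R) != 0 by rewrite gt_eqF // sqrtr_gt0; lra.
by move/(mulfI s_neq0)/intr_inj.
Qed.

End Lifting.

(** All squares lie in [[fset a ^+ 2; b ^+ 2]]; an angle -1 would put 1 in that set. *)
Lemma spans_biangular_lines_subset (R : realType) (d : nat)
    (X : {fset 'rV[R]_d}) (a b : R) :
  unit_vectors X -> a ^+ 2 != 1 -> b ^+ 2 != 1 ->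
  angle_set X `<=` [fset a; - a; b; - b] -> spans_biangular_lines X.
Proof.
move=> unitX a1 b1 /fsubsetP subX.
have sqX g : g \in angle_set X -> g ^+ 2 \in [fset a ^+ 2; b ^+ 2].
  by move=> /subX; rewrite !inE => /orP[/orP[/orP[]|]|] /eqP->;
    rewrite ?sqrrN eqxx ?orbT.
split=> //.
  apply/negP => /sqX; rewrite sqrrN expr1n !inE eq_sym (negPf a1).
  by rewrite eq_sym (negPf b1).
have /fsubset_leq_card/leq_trans -> // :
    [fset g ^+ 2 | g in angle_set X] `<=` [fset a ^+ 2; b ^+ 2].
  by apply/fsubsetP => _ /imfsetP[g /= gX ->]; apply: sqX.
by rewrite cardfs2; case: (_ != _).
Qed.

Theorem theorem2p8 (R : realType) (d : nat) (hd : (3 <= d)%N) :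
  exists X : {fset 'rV[R]_d},
    [/\ spans_biangular_lines X,
        #|` X| = (2 * (d - 1) * (d - 2))%N
      & angle_set X `<=` [fset 1 / 5; - (1 / 5); 3 / 5; - (3 / 5)]].
Proof.
case: d hd => // n _; rewrite subn1 subSS subn1 /=.
pose X := [fset lift_root R (root_vec p) | p in root_index n].
have unitX : unit_vectors X.
  move=> _ /imfsetP[p /= pn ->].
  by rewrite /enorm inner_lift_root dot_root_vec // -[RHS]sqrtr1; congr Num.sqrt; lra.
have angleX : angle_set X `<=` [fset 1 / 5; - (1 / 5); 3 / 5; - (3 / 5)].
  apply/fsubsetP => g /imfset2P[_ /imfsetP[p /= pn ->] [y]].
  rewrite !inE /= => /andP[/imfsetP[q /= qn ->] neq_pq] ->.
  rewrite inner_lift_root; set k := dot _ _.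
  (* These cases give the angles -3/5, -1/5, 1/5 and 3/5, in this order. *)
  have [] : [\/ k = -2, k = -1, k = 0 | k = 1].
    apply: dot_norm2_range; rewrite ?dot_root_vec // => eq_pq.
    by case/eqP: neq_pq; rewrite (root_vec_inj pn qn eq_pq).
  - by move=> ->; rewrite orbC (_ : _ == - (3 / 5)) //; apply/eqP; lra.
  - by move=> ->; rewrite (_ : _ == - (1 / 5)) ?orbT //; apply/eqP; lra.
  - by move=> ->; rewrite (_ : _ == 1 / 5) //; apply/eqP; lra.
  - by move=> ->; rewrite (_ : _ == 3 / 5) ?orbT //; apply/eqP; lra.
exists X; split=> //.
  by apply: (spans_biangular_lines_subset unitX _ _ angleX); rewrite lt_eqF //; lra.
(* Lifting and encoding are both injective, so no roots are identified and [X] is as large as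
   [root_index n], with n = d - 1. *)
rewrite card_in_imfset /= => [|p q pn qn /lift_root_inj]; last exact: root_vec_inj.
by rewrite -cardE card_root_index.
Qed.
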